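(* The hypergeometric series admits the symmetry $$F\left(\begin{matrix}a\\ B\end{matrix};x_1,x_2\right)=F\left(\begin{matrix}a_{\sigma(1)},&a_{\sigma(2)},&a_{\sigma(3)}\\ b_{\tau(1),\sigma_1(1)},&b_{\tau(1),\sigma_1(2)},&1\\ b_{\tau(2),\sigma_2(1)},&b_{\tau(2),\sigma_2(2)},&1\end{matrix}\ ;x_{\tau(1)},x_{\tau(2)}\right)$$ for every $\sigma$ in the symmetric group $S_3$ and all $\sigma_1,\sigma_2,\tau$ in the symmetric group $S_2$. The group of these transformations of the parameters and variables is isomorphic to the direct product $S_3\times D_4$ of $S_3$ and the dihedral group $D_4$ of order $8$.
   Context: For $\alpha\in\mathbb C$, $n\in\mathbb N=\{0,1,2,\dots\}$: $(\alpha,n)=\alpha(\alpha+1)\cdots(\alpha+n-1)$. Parameters $a=(a_1,a_2,a_3)$ and $B=\begin{pmatrix}b_{11}&b_{12}&b_{13}\\ b_{21}&b_{22}&b_{23}\end{pmatrix}$ with $b_{13}=b_{23}=1$ and $b_{11},b_{12},b_{21},b_{22}\notin\{0,-1,-2,\dots\}$; $$F\left(\begin{matrix}a\\ B\end{matrix};x\right)=\sum_{n_1,n_2=0}^\infty\prod_{j=1}^3\frac{(a_j,n_1+n_2)}{(b_{1j},n_1)(b_{2j},n_2)}\,x_1^{n_1}x_2^{n_2}.$$ *)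

(* Defs.v *)
From mathcomp Require Import all_boot all_order all_algebra all_fingroup.
From mathcomp Require Import all_solvable.
From mathcomp Require Import all_classical all_reals all_analysis complex.
From mathcomp Require summability.

Set Implicit Arguments.
Unset Strict Implicit.
Unset Printing Implicit Defensive.

Import GRing.Theory.
Import numFieldNormedType.Exports.
Local Open Scope classical_set_scope.
Local Open Scope ring_scope.
Local Open Scope complex_scope.

(* The complex numbers are R[i] for R : realType; R[i]^o is the same field seen
   as a normed module over itself, hence with its usual topology. *)

Definition pochhammer (K : pzRingType) (z : K) (n : nat) : K :=
  \prod_(k < n) (z + k%:R).

Definition hg_term (R : realType) (a : 'rV[R[i]]_3) (B : 'M[R[i]]_(2, 3))
    (x : 'rV[R[i]]_2) (n : nat * nat) : R[i]^o :=
  (\prod_(j < 3) (pochhammer (a 0 j) (n.1 + n.2) /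
      (pochhammer (B 0 j) n.1 * pochhammer (B 1 j) n.2)))
  * x 0 0 ^+ n.1 * x 0 1 ^+ n.2.

(* Double series are summed unconditionally, i.e. along the net of finite
   subsets of nat * nat. *)
Definition hg_sums_to (R : realType) (a : 'rV[R[i]]_3) (B : 'M[R[i]]_(2, 3))
    (x : 'rV[R[i]]_2) (s : R[i]^o) : Prop :=
  summability.partial_sum (hg_term a B x) @ summability.totally --> s.

(* Meaningful where the series converges, that is, when some s satisfies
   [hg_sums_to a B x s]. *)
Definition hgF (R : realType) (a : 'rV[R[i]]_3) (B : 'M[R[i]]_(2, 3))
    (x : 'rV[R[i]]_2) : R[i] :=
  summability.sum (hg_term a B x).

(* The matrix B whose first two columns are b and whose third column is 1. *)
Definition hg_B (R : realType) (b : 'M[R[i]]_2) : 'M[R[i]]_(2, 3) :=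
  row_mx b (const_mx 1 : 'cV[R[i]]_2).

Record hg_data (R : realType) := HgData {
  hg_a : 'rV[R[i]]_3;
  hg_b : 'M[R[i]]_2;
  hg_x : 'rV[R[i]]_2;
  hg_bP : forall (i j : 'I_2) (n : nat), hg_b i j != - n%:R }.

Section Transformations.
Variable R : realType.

Definition hg_permute_a (s : 'S_3) (a : 'rV[R[i]]_3) : 'rV[R[i]]_3 :=
  \row_j a 0 (s j).

Definition hg_permute_b (s1 s2 t : 'S_2) (b : 'M[R[i]]_2) : 'M[R[i]]_2 :=
  \matrix_(i, j) b (t i) (if i == 0 then s1 j else s2 j).

Definition hg_permute_x (t : 'S_2) (x : 'rV[R[i]]_2) : 'rV[R[i]]_2 :=
  \row_i x 0 (t i).

Lemma hg_permute_bP (s1 s2 t : 'S_2) (b : 'M[R[i]]_2) :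
  (forall (i j : 'I_2) (n : nat), b i j != - n%:R) ->
  forall (i j : 'I_2) (n : nat), hg_permute_b s1 s2 t b i j != - n%:R.
Proof. by move=> bP i j n; rewrite mxE. Qed.

Definition hg_transf (s : 'S_3) (s1 s2 t : 'S_2) (p : hg_data R) : hg_data R :=
  @HgData R (hg_permute_a s (hg_a p)) (hg_permute_b s1 s2 t (hg_b p))
    (hg_permute_x t (hg_x p)) (hg_permute_bP s1 s2 t (@hg_bP R p)).

Definition hg_transfs : set (hg_data R -> hg_data R) :=
  [set f | exists s s1 s2 t, f = hg_transf s s1 s2 t].

End Transformations.

Definition transformation_group (T : Type) (G : set (T -> T)) : Prop :=
  [/\ G id,
      forall f g, G f -> G g -> G (f \o g) &
      forall f, G f -> exists2 g, G g & cancel f g /\ cancel g f].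

Definition transformation_group_isog (T : Type) (G : set (T -> T))
    (gT : finGroupType) : Prop :=
  exists phi : gT -> T -> T,
    [/\ injective phi, range phi = G &
        forall u v, phi (u * v)%g = phi u \o phi v].

(* Main.v *)
Require Import Defs.
From mathcomp Require Import all_boot all_order all_algebra all_fingroup.
From mathcomp Require Import all_solvable.
From mathcomp Require Import all_classical all_reals all_analysis complex.
From mathcomp Require Import finmap zify.
From mathcomp Require summability.

Set Implicit Arguments.
Unset Strict Implicit.
Unset Printing Implicit Defensive.

Import GRing.Theory Num.Theory.
Local Open Scope ring_scope.
Local Open Scope complex_scope.

(** Symmetry of the series.  In the general term the [a_j] enter through one
    product over [j], and the entries of each row of [B] through one product
    over that row, so permuting the [a_j] or the entries of a row changes
    nothing.  Exchanging the two rows of [B] together with [x_1] and [x_2] turns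
    the term of index [(n_1, n_2)] into the term of index [(n_2, n_1)]
    ([hg_term_permute]); as the double series is summed along all finite sets of
    indices, it does not see a bijective reindexing ([partial_sum_reindex]).

    Structure of the group.  Index the entries of [b] by the cells [(i, j)] of a
    2 x 2 square.  The parameters [s1], [s2], [t] act on the cells by the
    permutation [(i, j) -> (t i, s_i j)], and these permutations form the group
    [row_group] (the wreath product of S_2 with S_2) of order 8.  It is generated
    by two distinct involutions, the exchange of the cells of the first row and
    the exchange of the rows, so it is dihedral ([row_group_dihedral]).  Every
    transformation is the action [data_act s w] of a pair [(s, w)] in
    S_3 x [row_group]: the action on the variables is read off [w], because [w]
    permutes the rows.  This action is multiplicative ([data_actM]), and it is
    faithful since one point with pairwise distinct [a_j] and pairwise distinct
    entries of [b] determines [s] and [w] ([data_act_inj]). *)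

(** * Reindexing an unconditional sum *)

Lemma partial_sum_reindex_sub (I J : choiceType) (V : zmodType) (f : J -> V)
    (h : I -> J) (g : J -> I) : cancel h g -> cancel g h ->
  (summability.partial_sum f @ summability.totally `<=`
   summability.partial_sum (f \o h) @ summability.totally)%classic.
Proof.
move=> hK gK P [A0 _ A0P]; exists [fset g j | j in A0]%fset => //= B sAB.
have sumE : summability.partial_sum (f \o h) B =
          summability.partial_sum f [fset h i | i in B]%fset.
  rewrite /summability.partial_sum.
  rewrite -(big_seq_fsetE _ _ predT f) -(big_seq_fsetE _ _ predT (f \o h)) /=.
  by rewrite big_imfset //= => x y _ _; apply: (can_inj hK).
rewrite /preimage /= sumE; apply: A0P.
apply/fsubsetP => j jA0; apply/imfsetP; exists (g j) => //=.
by apply: (fsubsetP sAB); apply/imfsetP; exists j.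
Qed.

(** A bijection of the indices maps the net of finite subsets onto itself, and
    each partial sum onto a partial sum, so both image filters agree. *)
Lemma partial_sum_reindex (I J : choiceType) (V : zmodType) (f : J -> V)
    (h : I -> J) (g : J -> I) : cancel h g -> cancel g h ->
  (summability.partial_sum (f \o h) @ summability.totally =
   summability.partial_sum f @ summability.totally)%classic.
Proof.
move=> hK gK; apply/seteqP; split; last exact: (partial_sum_reindex_sub hK gK).
have := partial_sum_reindex_sub (f := f \o h) gK hK.
by have -> : (f \o h) \o g = f by apply/funext => j /=; rewrite gK.
Qed.

(** * Symmetry of the general term *)

Lemma ord2P (i : 'I_2) : i = 0 \/ i = 1.
Proof. by case: i => [[|[|//]] ?]; [left | right]; apply: val_inj. Qed.

Lemma perm2P (t : 'S_2) : t = 1%g \/ t = tperm 0 1.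
Proof.
have [t0|t0] := ord2P (t 0); have [t1|t1] := ord2P (t 1).
- by have /perm_inj := etrans t0 (esym t1).
- by left; apply/permP => i; rewrite perm1; case: (ord2P i) => ->.
- by right; apply/permP => i; case: (ord2P i) => ->; rewrite ?tpermL ?tpermR.
- by have /perm_inj := etrans t0 (esym t1).
Qed.

Lemma hg_termE (R : realType) (a : 'rV[R[i]]_3) (b : 'M[R[i]]_2)
    (x : 'rV[R[i]]_2) (n : nat * nat) :
  hg_term a (hg_B b) x n =
  (\prod_j pochhammer (a 0 j) (n.1 + n.2)) /
    ((\prod_j pochhammer (b 0 j) n.1) * pochhammer 1 n.1 *
     ((\prod_j pochhammer (b 1 j) n.2) * pochhammer 1 n.2)) *
  x 0 0 ^+ n.1 * x 0 1 ^+ n.2.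
Proof.
have rowE (i : 'I_2) m : \prod_(j < 3) pochhammer (hg_B b i j) m =
    (\prod_j pochhammer (b i j) m) * pochhammer 1 m.
  rewrite /hg_B (@big_split_ord _ _ _ 2 1) big_ord1; congr (_ * _).
    by apply: eq_bigr => j _; congr pochhammer; apply: row_mxEl.
  by congr pochhammer; apply: etrans (row_mxEr _ _ _ _) _; rewrite mxE.
by rewrite /hg_term prodf_div big_split /= !rowE.
Qed.

Definition permute_pair (t : 'S_2) (n : nat * nat) : nat * nat :=
  if t == 1%g then n else (n.2, n.1).

Lemma permute_pairK t : involutive (permute_pair t).
Proof. by move=> [m n]; rewrite /permute_pair; case: eqP. Qed.

Lemma hg_term_permute (R : realType) (a : 'rV[R[i]]_3) (b : 'M[R[i]]_2)
    (x : 'rV[R[i]]_2) (s : 'S_3) (s1 s2 t : 'S_2) :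
  hg_term (hg_permute_a s a) (hg_B (hg_permute_b s1 s2 t b)) (hg_permute_x t x)
  = hg_term a (hg_B b) x \o permute_pair t.
Proof.
apply/funext => -[m n] /=; rewrite !hg_termE /=.
have aE k : \prod_j pochhammer (hg_permute_a s a 0 j) k =
            \prod_j pochhammer (a 0 j) k.
  by rewrite [RHS](reindex_perm s); apply: eq_bigr => j _; rewrite mxE.
have bE i k : \prod_j pochhammer (hg_permute_b s1 s2 t b i j) k =
              \prod_j pochhammer (b (t i) j) k.
  rewrite [RHS](reindex_perm (if i == 0 then s1 else s2)).
  by apply: eq_bigr => j _; rewrite mxE; case: ifP.
rewrite aE !bE !mxE /permute_pair.
have [->|->] := perm2P t; first by rewrite !perm1 eqxx.
rewrite tpermL tpermR ifN /=; last first.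
  by apply/eqP => /permP/(_ 0); rewrite tpermL perm1.
by rewrite [LHS]mulrAC addnC; congr (_ / _ * _ * _); rewrite mulrC.
Qed.

(** * The dihedral group of the entries of b *)

(** A cell [(i, j)] is sent to [(t i, s1 j)] or [(t i, s2 j)]: with this order
    of the factors, entry [(i, j)] of [hg_permute_b s1 s2 t b] is the entry of
    [b] at the image of [(i, j)]. *)
Definition row_fun (u : 'S_2 * 'S_2 * 'S_2) (p : 'I_2 * 'I_2) : 'I_2 * 'I_2 :=
  (u.2 p.1, (if p.1 == 0 then u.1.1 else u.1.2) p.2).

Lemma row_fun_inj u : injective (row_fun u).
Proof. by move=> [i j] [k l] [/perm_inj <- /perm_inj <-]. Qed.

Definition row_perm (u : 'S_2 * 'S_2 * 'S_2) : {perm 'I_2 * 'I_2} :=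
  perm (@row_fun_inj u).

Lemma row_permE u i j :
  row_perm u (i, j) = (u.2 i, (if i == 0 then u.1.1 else u.1.2) j).
Proof. by rewrite permE. Qed.

Lemma row_perm_inj : injective row_perm.
Proof.
move=> [[s1 s2] t] [[u1 u2] v] /permP E; congr (_, _, _); apply/permP => i.
- by have := E (0, i); rewrite !row_permE => -[].
- by have := E (1, i); rewrite !row_permE => -[].
- by have := E (i, 0); rewrite !row_permE => -[].
Qed.

Lemma row_perm1 : row_perm (1, 1, 1)%g = 1%g.
Proof. by apply/permP => -[i j]; rewrite row_permE !perm1 /= if_same perm1. Qed.

Lemma row_permM s1 s2 t u1 u2 v :
  (row_perm (s1, s2, t) * row_perm (u1, u2, v))%g =
  row_perm (s1 * (if t 0 == 0 then u1 else u2),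
            s2 * (if t 1%R == 0 then u1 else u2), t * v)%g.
Proof.
apply/permP => -[i j]; rewrite permM !row_permE /= permM; congr (_, _).
have [->|->] := ord2P i; first by rewrite eqxx permM.
by rewrite (_ : (1 == 0 :> 'I_2) = false) // permM.
Qed.

Lemma row_group_set : group_set (row_perm @: [set: 'S_2 * 'S_2 * 'S_2]).
Proof.
apply/group_setP; split; first by rewrite -row_perm1 imset_f ?inE.
move=> _ _ /imsetP[[[s1 s2] t] _ ->] /imsetP[[[u1 u2] v] _ ->].
by rewrite row_permM imset_f ?inE.
Qed.

Canonical row_group := Group row_group_set.

Lemma row_groupP w :
  reflect (exists s1 s2 t, w = row_perm (s1, s2, t)) (w \in row_group).
Proof.
apply: (iffP imsetP) => [[[[s1 s2] t] _ ->]|[s1 [s2 [t ->]]]].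
  by exists s1, s2, t.
by exists (s1, s2, t).
Qed.

Lemma card_row_group : #|row_group| = 8.
Proof. by rewrite (card_imset _ row_perm_inj) cardsT !card_prod card_Sn. Qed.

(** The exchange of the cells of the first row and the exchange of the rows are
    distinct involutions.  Conjugating the former by the latter gives the
    exchange inside the second row, so that together they generate the group,
    which is therefore dihedral of order 8. *)
Lemma row_group_dihedral : row_group \isog [set: dihedral_gtype 8].
Proof.
pose c : 'S_2 := tperm 0 1; have c_ne1 : c != 1%g.
  by apply/eqP => /permP/(_ 0); rewrite tpermL perm1.
have cc : (c * c = 1)%g by rewrite tperm2.
pose x := row_perm (c, 1, 1)%g; pose y := row_perm (1, 1, c)%g.
have x_ne1 : x != 1%g.
  by rewrite -row_perm1; apply: contraNneq c_ne1 => /row_perm_inj[->].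
have y_ne1 : y != 1%g.
  by rewrite -row_perm1; apply: contraNneq c_ne1 => /row_perm_inj[->].
have ord2 (w : {perm 'I_2 * 'I_2}) : w != 1%g -> (w * w = 1)%g -> #[w]%g = 2.
  by move=> w1 ww; apply: nt_prime_order; rewrite // expgS expg1.
have ox : #[x]%g = 2.
  by apply: ord2; rewrite // row_permM !perm1 /= cc !mulg1 row_perm1.
have oy : #[y]%g = 2.
  by apply: ord2; rewrite // row_permM !if_same cc !mulg1 row_perm1.
have ne_xy : x != y by apply: contraNneq c_ne1 => /row_perm_inj[->].
have defG : <<[set x; y]>>%g = row_group.
  apply/eqP; rewrite finset.eqEsubset gen_subG finset.subUset !finset.sub1set !imset_f ?inE //=.
  apply/fintype.subsetP => _ /row_groupP[s1 [s2 [t ->]]].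
  have xG : x \in <<[set x; y]>>%g by rewrite mem_gen ?set21.
  have yG : y \in <<[set x; y]>>%g by rewrite mem_gen ?set22.
  have zE : (y * x * y)%g = row_perm (1, c, 1)%g.
    by rewrite !row_permM !tpermL !tpermR /= !if_same !mul1g !mulg1 cc.
  have -> : row_perm (s1, s2, t) = (row_perm (s1, 1, 1) *
      (row_perm (1, s2, 1) * row_perm (1, 1, t)))%g.
    by rewrite !row_permM !perm1 /= !mulg1 !mul1g.
  rewrite !groupM //.
  - by have [->|->] := perm2P s1; rewrite ?row_perm1.
  - by have [->|->] := perm2P s2; rewrite ?row_perm1 // -zE !groupM.
  - by have [->|->] := perm2P t; rewrite ?row_perm1.
by have := involutions_gen_dihedral ox oy ne_xy; rewrite /= defG card_row_group.
Qed.

(** * The action on parameters and variables *)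

Lemma hg_data_eq (R : realType) (p q : hg_data R) :
  hg_a p = hg_a q -> hg_b p = hg_b q -> hg_x p = hg_x q -> p = q.
Proof.
case: p q => [a b x bP] [a' b' x' bP'] /= E1 E2 E3.
by move: bP bP'; rewrite E1 E2 E3 => bP bP'; rewrite (Prop_irrelevance bP bP').
Qed.

Section DataAction.
Variable R : realType.

Lemma cell_actP (w : {perm 'I_2 * 'I_2}) (p : hg_data R) :
  forall (i j : 'I_2) (n : nat),
    (\matrix_(i, j) hg_b p (w (i, j)).1 (w (i, j)).2 : 'M[R[i]]_2) i j
      != - n%:R.
Proof. by move=> i j n; rewrite mxE; apply: hg_bP. Qed.

(** For [w] in [row_group] the row of [w (i, j)] depends on [i] alone; column 0
    is an arbitrary choice that makes the action on the variables a function of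
    [w]. *)
Definition data_act (s : 'S_3) (w : {perm 'I_2 * 'I_2}) (p : hg_data R) :
    hg_data R :=
  @HgData R (hg_permute_a s (hg_a p))
    (\matrix_(i, j) hg_b p (w (i, j)).1 (w (i, j)).2)
    (\row_i hg_x p 0 (w (i, 0)).1) (cell_actP w p).

Lemma hg_transfE s s1 s2 t :
  @hg_transf R s s1 s2 t = data_act s (row_perm (s1, s2, t)).
Proof.
apply/funext => p; apply: hg_data_eq => //=.
  by apply/matrixP => i j; rewrite !mxE row_permE /=; case: ifP.
by apply/matrixP => i j; rewrite !mxE row_permE.
Qed.

Lemma hg_transfsP f : hg_transfs f <->
  exists s, exists2 w, w \in row_group & f = data_act s w.
Proof.
split=> [[s [s1 [s2 [t ->]]]]|[s [w /row_groupP[s1 [s2 [t ->]]] ->]]].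
  exists s, (row_perm (s1, s2, t)); last exact: hg_transfE.
  by apply/row_groupP; exists s1, s2, t.
by exists s, s1, s2, t; rewrite hg_transfE.
Qed.

Lemma data_act1 : data_act 1%g 1%g = id.
Proof.
apply/funext => p; apply: hg_data_eq => /=; apply/matrixP => i j.
- by rewrite !mxE perm1 ord1.
- by rewrite !mxE perm1.
- by rewrite !mxE perm1 ord1.
Qed.

(** Products of permutations compose from left to right, and a transformation
    substitutes into indices, which reverses the order once more: so the action
    is a homomorphism for composition.  Membership of [v] in [row_group] is what
    makes the action on the variables compatible. *)
Lemma data_actM s w u v : v \in row_group ->
  data_act (s * u)%g (w * v)%g = data_act s w \o data_act u v.
Proof.
move=> /row_groupP[v1 [v2 [t ->]]]; apply/funext => p.
apply: hg_data_eq => /=; apply/matrixP => i j.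
- by rewrite !mxE permM.
- by rewrite !mxE permM; case: (w (i, j)).
- by rewrite !mxE permM; case: (w (j, 0)) => k l; rewrite !row_permE.
Qed.

(** One witness separates all pairs [(s, w)]: its [a_j] are 0, 1, 2 and its
    [b_ij] are 1, 2, 3, 4, which are pairwise distinct and never nonpositive
    integers. *)
Lemma data_act_inj s w u v : data_act s w = data_act u v -> s = u /\ w = v.
Proof.
pose b0 : 'M[R[i]]_2 := \matrix_(i, j) (i * 2 + j).+1%:R.
have b0P (i j : 'I_2) (n : nat) : b0 i j != - n%:R.
  by rewrite mxE -subr_eq0 opprK -natrD pnatr_eq0.
pose p := @HgData R (\row_j (j : nat)%:R) b0 0 b0P.
move=> /(congr1 (fun f => f p))[Ea Eb].
split; apply/permP.
  move=> j; move/rowP/(_ j): Ea; rewrite !mxE => /eqP.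
  by rewrite eqr_nat => /eqP/val_inj.
move=> [i j]; move/matrixP/(_ i j): Eb; rewrite !mxE => /eqP.
rewrite eqr_nat eqSS; move: (w (i, j)) (v (i, j)) => [k l] [k' l'] /= /eqP E.
by congr (_, _); apply: val_inj; move: E (ltn_ord l) (ltn_ord l') => /=; lia.
Qed.

Lemma hg_transfs_group : transformation_group (@hg_transfs R).
Proof.
split.
- by apply/hg_transfsP; exists 1%g, 1%g; rewrite ?group1 ?data_act1.
- move=> _ _ /hg_transfsP[s [w wG ->]] /hg_transfsP[u [v vG ->]].
  apply/hg_transfsP; exists (s * u)%g, (w * v)%g; first by rewrite groupM.
  by rewrite data_actM.
- move=> _ /hg_transfsP[s [w wG ->]]; exists (data_act s^-1 w^-1)%g.
    by apply/hg_transfsP; exists s^-1%g, w^-1%g; rewrite ?groupV.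
  split=> p; [rewrite -[LHS]/((data_act _ _ \o data_act s w) p)
             |rewrite -[LHS]/((data_act s w \o data_act _ _) p)].
    by rewrite -data_actM // !mulVg data_act1.
  by rewrite -data_actM ?groupV // !mulgV data_act1.
Qed.

Lemma hg_transfs_isog :
  transformation_group_isog (@hg_transfs R) ('S_3 * dihedral_gtype 8)%type.
Proof.
have /isogP[f injf imf] : [set: dihedral_gtype 8] \isog row_group.
  by rewrite isog_sym row_group_dihedral.
have fG d : f d \in row_group by rewrite -imf mem_morphim ?inE.
exists (fun u => data_act u.1 (f u.2)); split.
- move=> [s d] [u e] /= /data_act_inj[-> E]; congr (_, _).
  by apply: (injmP injf); rewrite ?inE.
- apply/seteqP; split=> [_ [[s d] _ <-]|g /hg_transfsP[s [w]]] /=.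
    by apply/hg_transfsP; exists s, (f d).
  by rewrite -imf => /morphimP[d _ _ ->] ->; exists (s, d).
- by move=> [s d] [u e] /=; rewrite morphM ?inE // data_actM.
Qed.

End DataAction.

Theorem proposition2p2 (R : realType) :
  (forall (a : 'rV[R[i]]_3) (b : 'M[R[i]]_2) (x : 'rV[R[i]]_2),
     (forall (i j : 'I_2) (n : nat), b i j != - n%:R) ->
     forall (s : 'S_3) (s1 s2 t : 'S_2),
       (forall z : R[i],
          hg_sums_to a (hg_B b) x z <->
          hg_sums_to (hg_permute_a s a) (hg_B (hg_permute_b s1 s2 t b))
            (hg_permute_x t x) z)
       /\ hgF a (hg_B b) x =
          hgF (hg_permute_a s a) (hg_B (hg_permute_b s1 s2 t b))
            (hg_permute_x t x))
  /\ transformation_group (@hg_transfs R)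
  /\ transformation_group_isog (@hg_transfs R) ('S_3 * dihedral_gtype 8)%type.
Proof.
split; last by split; [apply: hg_transfs_group | apply: hg_transfs_isog].
move=> a b x _ s s1 s2 t.
have filterE := partial_sum_reindex (hg_term a (hg_B b) x)
  (permute_pairK t) (permute_pairK t).
by rewrite /hg_sums_to /hgF /summability.sum hg_term_permute filterE.
Qed.
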